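(* Assume that $$\sum_{j\in J'}e^i_j+\sum_{j\in J,\,l\in I,\,l\ne i}f^i_{lj}<1\qquad\text{for all } i\in I .$$ Let $c>C$ and let $(\phi_1,\dots,\phi_m)$ be a bounded positive solution of $$\phi_i(\xi)=\int_{\mathbb R}\frac{(1+d_i)\phi_i(y)\,k_i(\xi-c-y)}{1+d_i\Big(\phi_i(y)+\sum_{j\in J'}e^i_j\phi_i(y-cj)+\sum_{j\in J,\,l\in I,\,l\ne i}f^i_{lj}\phi_l(y-cj+c)\Big)}\,dy,\qquad i\in I,\ \xi\in\mathbb R,$$ satisfying $0<\phi_i(\xi)<1$ for $\xi\in\mathbb R$ and $\lim_{\xi\to-\infty}\phi_i(\xi)e^{-\lambda_i^c\xi}=1$ for $i\in I$. Then $$\lim_{\xi\to-\infty}\phi_i(\xi)=0,\qquad\lim_{\xi\to+\infty}\phi_i(\xi)=E_i,\qquad i\in I.$$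
   Context: Let $m,\tau\in\mathbb N$, $I=\{1,\dots,m\}$, $J=\{1,\dots,\tau\}$, $J'=\{1,\dots,\tau-1\}$. The parameters $e^i_j$ ($i\in I,j\in J'$) and $f^i_{lj}$ ($i,l\in I$, $l\ne i$, $j\in J$) are nonnegative and $d_i>0$ for $i\in I$. Each kernel $k_i:\mathbb R\to[0,\infty)$ is Lebesgue measurable and integrable, even ($k_i(x)=k_i(-x)$), with $\int_{\mathbb R}k_i(y)\,dy=1$ and $\int_{\mathbb R}k_i(y)e^{\lambda y}dy<\infty$ for every $\lambda\ge0$. Solutions are bounded uniformly continuous functions $\mathbb R\to\mathbb R^m$. For $\lambda\ge0,c\ge0$ put $\Lambda_i(\lambda,c)=(1+d_i)\int_{\mathbb R}e^{\lambda y-\lambda c}k_i(y)\,dy$, and $$C=\max_{i\in I}\left\{\inf_{\lambda>0}\frac{\ln\left((1+d_i)\int_{\mathbb R}e^{\lambda y}k_i(y)\,dy\right)}{\lambda}\right\}.$$ For $c>C$ and $i\in I$, $\lambda_i^c>0$ denotes the smallest positive root of $\Lambda_i(\cdot,c)=1$. Under the summation condition in the claim there is $\mathbf E=(E_1,\dots,E_m)$ with all $E_i>0$ and $E_i+\sum_{j\in J'}e^i_jE_i+\sum_{j\in J,\,l\in I,\,l\ne i}f^i_{lj}E_l=1$ for all $i\in I$; this is the $E_i$ in the claim. *)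

(* Defs.v *)
From HB Require Import structures.
From mathcomp Require Import all_boot all_order all_algebra.
From mathcomp Require Import all_classical all_reals all_analysis.
Set Implicit Arguments.
Unset Strict Implicit.
Unset Printing Implicit Defensive.
Import Order.TTheory GRing.Theory Num.Theory.
Import numFieldNormedType.Exports.
Local Open Scope classical_set_scope.
Local Open Scope ring_scope.

(* Integrals and measurability are with respect to the completed Lebesgue
   measure, so that kernels are Lebesgue (not only Borel) measurable.
   The indices j are natural numbers starting at 1: J' is 1 <= j < tau and
   J is 1 <= j < tau.+1; the values of e i j and f i l j outside these ranges,
   and those of f i i j, are irrelevant. *)
Notation Leb := completed_lebesgue_measure.

Definition is_kernel (R : realType) (k : R -> R) : Prop :=
  [/\ forall x, 0 <= k x,
      (@Leb R).-integrable [set: _] (EFin \o k),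
      forall x, k (- x) = k x,
      \int[@Leb R]_y k y = 1 &
      forall lambda : R, 0 <= lambda ->
        (\int[@Leb R]_y (k y * expR (lambda * y))%:E < +oo)%E].

Definition Lambda (R : realType) (d : R) (k : R -> R) (lambda c : R) : R :=
  (1 + d) * \int[@Leb R]_y (expR (lambda * y - lambda * c) * k y).

Definition is_smallest_pos_root (R : realType) (g : R -> R) (a x : R) : Prop :=
  [/\ 0 < x, g x = a & forall y, 0 < y -> g y = a -> x <= y].

Definition speed (R : realType) (d : R) (k : R -> R) : R :=
  inf [set ln ((1 + d) * \int[@Leb R]_y (expR (lambda * y) * k y)) / lambda
      | lambda in [set lambda : R | 0 < lambda]].

(* The maximum is taken in the extended reals only to have a neutral element;
   it is finite as soon as 0 < m. *)
Definition Cmax (R : realType) (m : nat) (d : 'I_m -> R)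
    (k : 'I_m -> R -> R) : \bar R :=
  \big[maxe/-oo%E]_(i < m) (speed (d i) (k i))%:E.

Definition competition_sum (R : realType) (m tau : nat) (e : 'I_m -> nat -> R)
    (f : 'I_m -> 'I_m -> nat -> R) (i : 'I_m) : R :=
  \sum_(1 <= j < tau) e i j
  + \sum_(1 <= j < tau.+1) \sum_(l < m | l != i) f i l j.

Definition is_equilibrium (R : realType) (m tau : nat) (e : 'I_m -> nat -> R)
    (f : 'I_m -> 'I_m -> nat -> R) (E : 'I_m -> R) : Prop :=
  forall i, E i + \sum_(1 <= j < tau) e i j * E i
    + \sum_(1 <= j < tau.+1) \sum_(l < m | l != i) f i l j * E l = 1.

Definition wave_competition (R : realType) (m tau : nat) (e : 'I_m -> nat -> R)
    (f : 'I_m -> 'I_m -> nat -> R) (c : R) (phi : 'I_m -> R -> R)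
    (i : 'I_m) (y : R) : R :=
  phi i y + \sum_(1 <= j < tau) e i j * phi i (y - c * j%:R)
  + \sum_(1 <= j < tau.+1) \sum_(l < m | l != i)
      f i l j * phi l (y - c * j%:R + c).

Definition is_wave (R : realType) (m tau : nat) (d : 'I_m -> R)
    (k : 'I_m -> R -> R) (e : 'I_m -> nat -> R)
    (f : 'I_m -> 'I_m -> nat -> R) (c : R) (phi : 'I_m -> R -> R) : Prop :=
  forall i xi, phi i xi =
    \int[@Leb R]_y ((1 + d i) * phi i y * k i (xi - c - y)
      / (1 + d i * wave_competition tau e f c phi i y)).

(* Main.v *)
Require Import Defs.
From HB Require Import structures.
From mathcomp Require Import all_boot all_order all_algebra.
From mathcomp Require Import all_classical all_reals all_analysis.
From mathcomp Require Import measurable_realfun ring lra.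
Import Order.TTheory GRing.Theory Num.Theory.
Import numFieldNormedType.Exports.
Local Open Scope classical_set_scope.
Local Open Scope ring_scope.

(** Since [lambda i > 0], the limit at minus infinity is read off the prescribed
    exponential asymptotics. The work is at plus infinity.

    The wave equation says that [phi i xi] is the average, against the even
    probability density [k i] centred at [xi - c], of the growth function
    [(1 + d i) * phi i / (1 + d i * W i)], where [W i] is the competition felt by
    species [i] ([kernel_convolution] brings the integral to this form). Two
    facts about such averages carry the proof: they may be symmetrised, because
    the density is even, and they depend on far away values only up to an
    arbitrarily small error ([kernel_average_tight]).

    - The speed [c] is positive. By evenness and convexity of the exponential,
      the exponential moments of [k i] are at least 1
      ([kernel_exp_moment_ge1]), so the critical speed is nonnegative.

    - No species dies out behind the front ([wave_persistence]). As
      [phi l < 1] and the competition sum [q] is less than 1, one has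
      [W i <= phi i + q], so at low density the growth function is at least
      [rho * phi i] for some [rho > 1]. Symmetric averages map a cosine to a
      multiple of itself, and the factor is close to 1 when the wave length is
      large. Hence the positive arch of a small and flat cosine, moving with
      speed [c], is a subsolution: by induction on [n] it stays below
      [x |-> phi i (x + c * n)] ([persistence]). Because [c > 0], the
      translates of the middle part of this arch cover a half-line.

    - The limits are squeezed together. Let [S] and [I] be the vectors of upper
      and lower limits of [phi] at plus infinity; persistence gives [I > 0].
      The growth function increases with the present density of its own species
      and decreases with the rest of the competition, so passing to the limit in
      the averages gives [S i + load i I <= 1 <= I i + load i S], where [load i]
      is linear with nonnegative coefficients of sum less than 1
      ([limsup_wave_load], [liminf_wave_load]). Comparing with
      [E i + load i E = 1] at the species for which
      [max (S i - E i, E i - I i)] is largest, this maximum is at most a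
      fraction of itself, hence nonpositive, and [S <= E <= I]. *)

(** * Reflections preserve the completed Lebesgue measure *)

(** The completed Lebesgue measure lives on the line with the sigma-algebra of
    the sets that are Caratheodory-measurable for the outer measure. *)
Notation Lebtype R :=
  (caratheodory_type (R:=R) (wlength (R:=R) idfun)^*%mu).

Section reflection.
Context {R : realType}.
Local Open Scope ereal_scope.

Let reflectK (a : R) (A : set R) :
  (fun y => a - y)%R @^-1` ((fun y => a - y)%R @^-1` A) = A.
Proof. by apply/funext => y; rewrite /preimage /= subKr. Qed.

(** Reflecting a cover preserves the sum of its lengths. The interval [`]x, y]]
    becomes [`[a - y, a - x[], which is closed on the wrong side to be used in
    covers, so its outer measure is found through the Lebesgue measure. *)
Let Leb_reflect_le (a : R) (A : set R) :
  @Leb R ((fun y => a - y)%R @^-1` A) <= @Leb R A.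
Proof.
apply: le_ereal_inf_tmp => _ /= [F [mF AF] <-].
apply: (@le_trans _ _ (\sum_(0 <= n <oo) @Leb R ((fun y => a - y)%R @^-1` F n))).
  apply: le_trans.
    exact: (@le_outer_measure _ _ ((wlength (R:=R) idfun)^*%mu) _ _ (preimage_subset AF)).
  rewrite preimage_bigcup.
  exact: (@outer_measure_sigma_subadditive _ _ ((wlength (R:=R) idfun)^*%mu)
            (fun n => (fun y => a - y)%R @^-1` F n)).
apply: lee_nneseries => // n _.
have [[x y] _ /= <-] := mF n.
have -> : (fun y => a - y)%R @^-1` `]x, y]%classic = `[a - y, a - x[%classic%R.
  by apply/seteqP; split=> t /=; rewrite !in_itv/= => /andP[? ?]; apply/andP; split; lra.
rewrite -[X in X <= _]/(lebesgue_measure `[a - y, a - x[%classic%R).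
rewrite lebesgue_measure_itv wlength_itv/= !lte_fin.
have -> : (a - y < a - x)%R = (x < y)%R by apply/idP/idP => ?; lra.
by case: ifP => // _; rewrite -!EFinB lee_fin; lra.
Qed.

(** A reflection is its own inverse, so one inequality gives the equality. It is
    an equality of outer measures, valid for every set; this is what makes
    reflections preserve measurability below. *)
Lemma Leb_reflect (a : R) (A : set R) :
  @Leb R ((fun y => a - y)%R @^-1` A) = @Leb R A.
Proof.
apply/eqP; rewrite eq_le Leb_reflect_le /=.
by rewrite -{1}(reflectK a A) Leb_reflect_le.
Qed.

Lemma measurable_reflect (a : R) :
  measurable_fun setT ((fun y => a - y)%R : Lebtype R -> Lebtype R).
Proof.
move=> _ A mA; rewrite setTI.
have AE (X : set R) : @Leb R X = @Leb R (X `&` A) + @Leb R (X `&` ~` A) by exact: mA.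
suff BE (X : set R) : @Leb R X = @Leb R (X `&` ((fun y => a - y)%R @^-1` A))
    + @Leb R (X `&` ~` ((fun y => a - y)%R @^-1` A)) by exact: BE.
rewrite -(Leb_reflect a X) AE.
by congr (_ + _); rewrite -[LHS](Leb_reflect a) preimage_setI reflectK.
Qed.

Lemma integral_reflect (a : R) (g : Lebtype R -> \bar R) :
  measurable_fun setT g -> (forall y, 0 <= g y) ->
  \int[@Leb R]_y g (a - y)%R = \int[@Leb R]_y g y.
Proof.
move=> mg g0.
have := @ge0_integral_pushforward _ _ (Lebtype R) (Lebtype R) R _
  (measurable_reflect a) (@Leb R) setT g measurableT mg (fun y _ => g0 y).
rewrite preimage_setT => <-.
congr (integral _ _ _); apply/funext => A.
by rewrite /= /pushforward; exact: Leb_reflect.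
Qed.

End reflection.

(** * Averages against an even kernel *)

Section kernel_average.
Context {R : realType}.

Lemma measurable_Leb (g : R -> R) :
  measurable_fun setT g -> measurable_fun (T := Lebtype R) setT g.
Proof.
move=> mg _ B mB; rewrite setTI; apply: sub_caratheodory.
by have := mg measurableT B mB; rewrite setTI.
Qed.

Lemma continuous_Leb (g : R -> R) :
  continuous g -> measurable_fun (T := Lebtype R) setT g.
Proof. by move=> cg; apply: measurable_Leb; exact: continuous_measurable_fun. Qed.

Variable k : R -> R.
Hypothesis kerk : is_kernel k.

Let k0 x : 0 <= k x. Proof. by have [H _ _ _ _] := kerk; exact: H. Qed.
Let ik : (@Leb R).-integrable [set: _] (EFin \o k).
Proof. by have [_ H _ _ _] := kerk. Qed.
Let mk : measurable_fun (T := Lebtype R) setT k.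
Proof. by apply/measurable_EFinP; exact: measurable_int ik. Qed.

(** With [a = xi - c] this turns the integral in the wave equation into an
    average against the probability density [k]. *)
Lemma kernel_convolution (g : R -> R) (a : R) :
  measurable_fun (T := Lebtype R) setT g -> (forall y, 0 <= g y) ->
  \int[@Leb R]_y (g y * k (a - y)) = \int[@Leb R]_z (g (a - z) * k z).
Proof.
move=> mg g0; congr fine.
rewrite -(integral_reflect a) => [||y]; last 2 first.
- apply/measurable_EFinP/measurable_funM => //.
  exact: (measurableT_comp mk (measurable_reflect a)).
- by rewrite lee_fin mulr_ge0.
by apply: eq_integral => y _; rewrite subKr.
Qed.

Lemma kernel_average_sym (g : R -> R) :
  measurable_fun (T := Lebtype R) setT g -> (forall y, 0 <= g y) ->
  \int[@Leb R]_z (g z * k z) = \int[@Leb R]_z (g (- z) * k z).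
Proof.
move=> mg g0; have [_ _ evk _ _] := kerk.
under [RHS]eq_Rintegral do rewrite -sub0r.
rewrite -kernel_convolution//.
by apply: eq_Rintegral => y _; rewrite sub0r evk.
Qed.

Lemma kernel_average_integrable (g : R -> R) (M : R) :
  measurable_fun (T := Lebtype R) setT g -> (forall y, 0 <= g y <= M) ->
  (@Leb R).-integrable setT (fun z => (g z * k z)%:E).
Proof.
move=> mg gM.
apply: (@le_integrable _ _ _ (@Leb R) _ _ _ (fun z => (M%:E * (k z)%:E)%E)) => //.
- by apply/measurable_EFinP/measurable_funM.
- move=> z _; have /andP[g0 gm] := gM z.
  by rewrite -EFinM lee_fin !ger0_norm ?mulr_ge0 ?ler_wpM2r// (le_trans g0).
- exact: integrableZl.
Qed.

(** For negative [l], evenness of the kernel reduces to the case of [- l]. *)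
Lemma kernel_exp_integrable (l : R) :
  (@Leb R).-integrable setT (fun z => (expR (l * z) * k z)%:E).
Proof.
have mexp (l' : R) : measurable_fun (T := Lebtype R) setT (fun z => expR (l' * z)).
  by apply: continuous_Leb => z; apply: continuous_comp;
    [exact: mulrl_continuous | exact: continuous_expR].
have fin (l' : R) : 0 <= l' ->
    (\int[@Leb R]_z (expR (l' * z) * k z)%:E < +oo)%E.
  have [_ _ _ _ H /H] := kerk.
  by under eq_integral do rewrite mulrC.
apply/integrableP; split.
  by apply/measurable_EFinP/measurable_funM.
under eq_integral do rewrite gee0_abs ?lee_fin ?mulr_ge0 ?expR_ge0//.
have [/fin//|l0] := leP 0 l.
rewrite -(integral_reflect 0) => [||z].
- under eq_integral do rewrite sub0r mulrN -mulNr.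
  have [_ _ evk _ _] := kerk.
  by under eq_integral do rewrite evk; apply: fin; lra.
- by apply/measurable_EFinP/measurable_funM.
- by rewrite lee_fin mulr_ge0 ?expR_ge0.
Qed.

(** By evenness the moments of order [l] and [- l] agree, and
    [expR (l * z) + expR (- l * z) >= 2]. *)
Lemma kernel_exp_moment_ge1 (l : R) :
  1 <= \int[@Leb R]_z (expR (l * z) * k z).
Proof.
have [_ _ _ k1 _] := kerk.
have mexp : measurable_fun (T := Lebtype R) setT (fun z => expR (l * z)).
  by apply: continuous_Leb => z; apply: continuous_comp;
    [exact: mulrl_continuous | exact: continuous_expR].
have := kernel_average_sym _ mexp (fun z => expR_ge0 _).
under [X in _ = X -> _]eq_Rintegral do rewrite mulrN -mulNr.
have i1 := kernel_exp_integrable l; have i2 := kernel_exp_integrable (- l).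
suff : 2 * 1 <= \int[@Leb R]_z (expR (l * z) * k z)
    + \int[@Leb R]_z (expR (- l * z) * k z) by lra.
rewrite -k1 -RintegralZl// -RintegralD//; apply: le_Rintegral => //.
- by under [X in _.-integrable _ X]funext => z do rewrite /= EFinM;
    exact: integrableZl.
- by under [X in _.-integrable _ X]funext => z do rewrite /= EFinD;
    exact: integrableD.
move=> z _; rewrite -mulrDl ler_wpM2r//.
have := expR_ge1Dx (l * z); have := expR_ge1Dx (- l * z); lra.
Qed.

(** A smooth majorant of the indicator of the complement of [[-A, A]]. Its
    average is [expR (- A)] times a constant, which bounds the mass of the
    kernel outside [[-A, A]] without integrating over subsets. *)
Let tail (A z : R) := expR (z - A) + expR (- z - A).

Let tail_ge0 A z : 0 <= tail A z.
Proof. by rewrite addr_ge0 ?expR_ge0. Qed.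

Let tail_ge1 A z : A < `|z| -> 1 <= tail A z.
Proof.
rewrite /tail => Az; have e1 := expR_ge0 (z - A); have e2 := expR_ge0 (- z - A).
have [z0|z0] := leP 0 z; [move: Az; rewrite ger0_norm// => Az|
  move: Az; rewrite ltr0_norm// => Az].
  have := expR_ge1Dx (z - A); lra.
have := expR_ge1Dx (- z - A); lra.
Qed.

Let tailE A z :
  tail A z * k z = expR (- A) * (expR (1 * z) * k z + expR (-1 * z) * k z).
Proof. by rewrite /tail !expRD mul1r mulN1r; ring. Qed.

Let exp_sum_integrable : (@Leb R).-integrable setT
  (fun z => (expR (1 * z) * k z + expR (-1 * z) * k z)%:E).
Proof.
under [X in _.-integrable _ X]funext => z do rewrite /= EFinD.
by apply: integrableD => //; exact: kernel_exp_integrable.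
Qed.

Let tail_integrable A :
  (@Leb R).-integrable setT (fun z => (tail A z * k z)%:E).
Proof.
under [X in _.-integrable _ X]funext => z do rewrite tailE /= EFinM.
exact: integrableZl.
Qed.

Let tail_small (eta : R) : 0 < eta ->
  exists2 A, 0 < A & \int[@Leb R]_z (tail A z * k z) <= eta.
Proof.
move=> eta0.
have tailI A : \int[@Leb R]_z (tail A z * k z) = expR (- A) *
    (\int[@Leb R]_z (expR (1 * z) * k z) + \int[@Leb R]_z (expR (-1 * z) * k z)).
  under eq_Rintegral do rewrite tailE.
  by rewrite RintegralZl// RintegralD//; exact: kernel_exp_integrable.
have := kernel_exp_moment_ge1 1; have := kernel_exp_moment_ge1 (-1).
move: tailI; move: (\int[_]_z _) (\int[_]_z _) => I1 I2 tailI ? ?.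
have I0 : 0 < I2 + I1 by lra.
exists ((I2 + I1) / eta); first by rewrite divr_gt0.
rewrite tailI expRN mulrC ler_pdivrMr ?expR_gt0//.
rewrite -ler_pdivrMl// mulrC.
have := expR_ge1Dx ((I2 + I1) / eta); lra.
Qed.

Let sym (g : R -> R) z := (g z + g (- z)) / 2.

Let sym_integrable (g : R -> R) (M : R) :
  measurable_fun (T := Lebtype R) setT g -> (forall y, 0 <= g y <= M) ->
  (@Leb R).-integrable setT (fun z => (sym g z * k z)%:E).
Proof.
move=> mg gM; apply: (@kernel_average_integrable _ M) => [|z].
  apply: measurable_funM => //; apply: measurable_funD => //.
  under [X in measurable_fun _ X]funext => z do rewrite -sub0r.
  exact: (measurableT_comp mg (measurable_reflect 0)).
by have := gM z; have := gM (- z); rewrite /sym; lra.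
Qed.

Let kernel_average_symE (g : R -> R) (M : R) :
  measurable_fun (T := Lebtype R) setT g -> (forall y, 0 <= g y <= M) ->
  \int[@Leb R]_z (g z * k z) = \int[@Leb R]_z (sym g z * k z).
Proof.
move=> mg gM.
have mgN : measurable_fun (T := Lebtype R) setT (fun z => g (- z)).
  under [X in measurable_fun _ X]funext => z do rewrite -sub0r.
  exact: (measurableT_comp mg (measurable_reflect 0)).
have ig := kernel_average_integrable _ _ mg gM.
have igN := kernel_average_integrable _ _ mgN (fun z => gM (- z)).
rewrite /sym; under [RHS]eq_Rintegral do rewrite mulrAC mulrC mulrDl.
rewrite RintegralZl//; last first.
  by under [X in _.-integrable _ X]funext => z do rewrite /= EFinD;
    exact: integrableD.
rewrite RintegralD// -kernel_average_sym// => [|y]; last by case/andP: (gM y).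
by move: (Rintegral _ _ _) => I; field.
Qed.

(** Far away values of [g], between [0] and [M], contribute at most [M * eta].
    The lower bound asks for an estimate of the even part of [g] only, since the
    odd part has average zero. The cut-off [A] depends on [eta] alone, not on
    [g]: this allows [g] to be translated to infinity. *)
Lemma kernel_average_tight (eta : R) : 0 < eta -> exists2 A, 0 < A &
  forall (g : R -> R) (M a : R), 0 <= a ->
    measurable_fun (T := Lebtype R) setT g -> (forall y, 0 <= g y <= M) ->
  ((forall z, `|z| <= A -> g z <= a) ->
     \int[@Leb R]_z (g z * k z) <= a + M * eta) /\
  ((forall z, `|z| <= A -> 2 * a <= g z + g (- z)) ->
     a * (1 - eta) <= \int[@Leb R]_z (g z * k z)).
Proof.
move=> /tail_small[A A0 At]; exists A => // g M a a0 mg gM.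
have [_ _ _ k1 _] := kerk.
have M0 : 0 <= M by have /andP[/le_trans] := gM 0; exact.
have ig := kernel_average_integrable _ _ mg gM.
have iat (b : R) : (@Leb R).-integrable setT
    (fun z => (a * k z + b * (tail A z * k z))%:E).
  under [X in _.-integrable _ X]funext => z do rewrite EFinD !EFinM.
  apply: integrableD => //; apply: integrableZl => //.
  by under [X in _.-integrable _ X]funext => z do rewrite -EFinM.
have Iat (b : R) : \int[@Leb R]_z (a * k z + b * (tail A z * k z)) =
    a + b * \int[@Leb R]_z (tail A z * k z).
  have ia : (@Leb R).-integrable setT (fun z => (a * k z)%:E).
    by under [X in _.-integrable _ X]funext => z do rewrite /= EFinM;
      exact: integrableZl.
  have ib : (@Leb R).-integrable setT (fun z => (b * (tail A z * k z))%:E).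
    by under [X in _.-integrable _ X]funext => z do rewrite EFinM;
      exact: integrableZl.
  rewrite RintegralD// RintegralZl// RintegralZl ?k1 ?mulr1//.
  exact: tail_integrable.
split=> gA.
- apply: (@le_trans _ _ (a + M * \int[@Leb R]_z (tail A z * k z))).
    rewrite -Iat; apply: le_Rintegral => //; first exact: iat.
    move=> z _.
    rewrite mulrA -mulrDl ler_wpM2r//.
    have [/gA|/tail_ge1 Az] := leP `|z| A.
      by move=> /le_trans; apply; rewrite lerDl mulr_ge0.
    have /andP[_ /le_trans] := gM z; apply.
    by rewrite ler_wpDl// ler_peMr.
  by rewrite lerD2l ler_wpM2l.
- rewrite (kernel_average_symE _ _ mg gM).
  apply: (@le_trans _ _ (a + - a * \int[@Leb R]_z (tail A z * k z))).
    by rewrite mulrDr mulr1 lerD2l mulrN mulNr lerN2 ler_wpM2l.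
  rewrite -Iat; apply: le_Rintegral => //; [exact: iat | exact: sym_integrable mg gM |].
  move=> z _; rewrite mulrA -mulrDl ler_wpM2r// /sym.
  have /andP[g1 _] := gM z; have /andP[g2 _] := gM (- z).
  have [/gA|/tail_ge1 Az] := leP `|z| A.
    have := mulr_ge0 a0 (tail_ge0 A z); lra.
  have : a <= a * tail A z by rewrite ler_peMr.
  lra.
Qed.

End kernel_average.

(** * Persistence behind a front *)

Section persistence.
Context {R : realType}.

Lemma cos_near0 (eta : R) : 0 < eta ->
  exists2 t : R, 0 < t < pi / 2 & forall x, `|x| <= t -> 1 - eta <= cos x.
Proof.
move=> eta0.
have := @continuous_cos R 0 => /cvgrPdist_le /(_ eta eta0).
rewrite cos0 => -[r /= r0 rP].
have pi2 := pi_gt0 R.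
have [t [t0 tr tpi]] : exists t : R, [/\ 0 < t, t <= r / 2 & t <= pi / 4].
  exists (Num.min (r / 2) (pi / 4)).
  rewrite lt_min !ge_min !lexx orbT; split=> //; apply/andP; split; lra.
exists t; first by apply/andP; split; lra.
move=> x xt; have : `|1 - cos x| <= eta.
  by apply: rP; rewrite /= sub0r normrN; move: xt; move: (`|x|) => y *; lra.
by rewrite ler_norml; lra.
Qed.

Lemma cos_le0 (x : R) : pi / 2 <= `|x| <= pi -> cos x <= 0.
Proof.
rewrite -cos_norm => /andP[h1 h2].
have -> : cos `|x| = - cos (`|x| - pi) by rewrite -{1}(subrK pi `|x|) cosDpi.
rewrite oppr_le0 cos_ge0_pihalf//; have := pi_gt0 R.
by move: (`|x|) h1 h2 => y *; lra.
Qed.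

(** If [F] amplifies small values of [u] by a factor [rho > 1], the arch
    [x |-> eps * cos (gam * x)], [`|gam * x| <= pi / 2], stays below
    [x |-> u (x + c * n)] for all [n]. Averaging symmetrically over [`|z| <= A]
    multiplies a cosine by at least [cos (gam * A)], because
    [cos (gam * (x - z)) + cos (gam * (x + z))
     = 2 * cos (gam * x) * cos (gam * z)];
    this factor and the kernel mass of [[-A, A]] are both made at least
    [1 - eta], with [rho * (1 - eta) ^+ 2 >= 1]. For [gam] small the
    interval [[0, c]] lies inside the arch, and its translates by the multiples
    of [c > 0] cover the nonnegative half-line. *)
Lemma persistence (k u F : R -> R) (c rho delta M : R) :
  is_kernel k -> 0 < c -> 1 < rho -> 0 < delta ->
  continuous u -> (forall y, 0 < u y) ->
  measurable_fun (T := Lebtype R) setT F -> (forall y, 0 <= F y <= M) ->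
  (forall xi, u xi = \int[@Leb R]_z (F (xi - c - z) * k z)) ->
  (forall y, rho * Num.min (u y) delta <= F y) ->
  exists2 b, 0 < b & forall xi, 0 <= xi -> b <= u xi.
Proof.
move=> kerk c0 rho1 delta0 cu u0 mF FM uE Fge.
have rho0 : 0 < rho by lra.
(* chosen so that [(1 - eta) ^+ 2 >= 1 - 2 * eta = rho^-1] *)
pose eta := (1 - rho^-1) / 2.
have rhoV : rho * rho^-1 = 1 by rewrite divff ?gt_eqF.
have rhoV1 : rho^-1 < 1 by rewrite invf_lt1.
have rhoV0 : 0 < rho^-1 by rewrite invr_gt0.
have eta0 : 0 < eta by rewrite /eta; lra.
have eta1 : eta < 1 by rewrite /eta; lra.
have gain : 1 <= rho * (1 - eta) ^+ 2.
  have : rho^-1 <= (1 - eta) ^+ 2 by rewrite /eta; nra.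
  by move=> /(ler_wpM2l (ltW rho0)); rewrite rhoV.
have [A A0 kA] := kernel_average_tight k kerk eta eta0.
have [t /andP[t0 tpi] cost] := cos_near0 eta eta0.
have pi0 : 0 < pi := pi_gt0 R.
have tpi2 : pi / 2 + t <= pi by lra.
(* [B] bounds both the averaging range [A] and the step [c] of the cover *)
pose B := A + c.
have B0 : 0 < B by rewrite addr_gt0.
pose gam := t / B.
have gam0 : 0 < gam by rewrite divr_gt0.
have gamB : gam * B = t by rewrite /gam divfK ?gt_eqF.
have gamle z : `|z| <= B -> `|gam * z| <= t.
  by move=> zB; rewrite normrM (gtr0_norm gam0) -gamB ler_wpM2l// ltW.
pose r := pi / 2 / gam.
have r0 : 0 < r by rewrite !divr_gt0.
have [x0 _ x0min] : exists2 x0, x0 \in `[- r, r] &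
    forall x, x \in `[- r, r] -> u x0 <= u x.
  apply: EVT_min; first by rewrite (@le_trans _ _ 0) ?oppr_le0 ?ltW.
  exact: continuous_subspaceT.
pose eps := Num.min (u x0) delta.
have eps0 : 0 < eps by rewrite /eps lt_min u0 delta0.
have bump n x : `|gam * x| <= pi / 2 -> eps * cos (gam * x) <= u (x + c * n%:R).
  elim: n x => [|n IHn] x xr.
    rewrite mulr0 addr0 (@le_trans _ _ eps)//.
      by rewrite ler_piMr ?cos_le1// ltW.
    rewrite /eps ge_min x0min// in_itv/= -ler_norml /r.
    by rewrite ler_pdivlMr// mulrC -{1}(gtr0_norm gam0) -normrM.
  (* beyond the arch, but before the next one, the cosine is nonpositive, so
     the induction hypothesis extends to all points met in the average *)
  have IH x' : `|gam * x'| <= pi -> eps * cos (gam * x') <= u (x' + c * n%:R).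
    move=> x'r; have [/IHn//|x'pi] := leP `|gam * x'| (pi / 2).
    apply: (@le_trans _ _ 0); last exact: ltW.
    by rewrite pmulr_rle0// cos_le0// x'r ltW.
  have FIH x' : `|gam * x'| <= pi -> rho * (eps * cos (gam * x')) <= F (x' + c * n%:R).
    move=> /IH IHx; apply: le_trans (Fge _).
    rewrite ler_pM2l// le_min IHx (@le_trans _ _ eps)//.
      by rewrite ler_piMr ?cos_le1// ltW.
    by rewrite /eps ge_min lexx orbT.
  have cx0 : 0 <= cos (gam * x) by apply: cos_ge0_pihalf; rewrite -ler_norml.
  have -> : x + c * n.+1%:R = x + c * n%:R + c by rewrite -natr1; ring.
  rewrite uE addrK.
  pose a := rho * eps * cos (gam * x) * (1 - eta).
  have a0 : 0 <= a by rewrite /a !mulr_ge0 ?subr_ge0 ?(ltW rho0) ?(ltW eps0) ?(ltW eta1).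
  apply: (@le_trans _ _ (a * (1 - eta))).
    have ec : 0 <= eps * cos (gam * x) by rewrite mulr_ge0// ltW.
    have := ler_wpM2r ec gain; rewrite mul1r /a expr2.
    by move=> /le_trans; apply; rewrite le_eqVlt; apply/orP; left; apply/eqP; ring.
  have mFx : measurable_fun (T := Lebtype R) setT (fun z => F (x + c * n%:R - z)).
    exact: (measurableT_comp mF (measurable_reflect _)).
  apply: (kA _ M a a0 mFx (fun z => FM _)).2 => z zA.
  have zt : `|gam * z| <= t by rewrite gamle// (le_trans zA)// lerDl ltW.
  have Fm : rho * (eps * cos (gam * (x - z))) <= F (x + c * n%:R - z).
    by rewrite addrAC FIH// mulrBr (le_trans (ler_normB _ _))//
      (le_trans _ tpi2)// lerD.
  have Fp : rho * (eps * cos (gam * (x + z))) <= F (x + c * n%:R - - z).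
    by rewrite opprK addrAC FIH// mulrDr (le_trans (ler_normD _ _))//
      (le_trans _ tpi2)// lerD.
  apply: le_trans (lerD Fm Fp).
  rewrite mulrBr mulrDr cosB cosD.
  have w0 : 0 <= 2 * (rho * eps * cos (gam * x)).
    by rewrite !mulr_ge0// ltW.
  apply: le_trans (le_trans _ (ler_wpM2l w0 (cost _ zt))) _;
    rewrite le_eqVlt; apply/orP; left; apply/eqP; rewrite /a; ring.
exists (eps * (1 - eta)); first by rewrite mulr_gt0// subr_gt0.
move=> xi xi0.
have xic : 0 <= xi / c by rewrite divr_ge0// ltW.
have /andP[n1 n2] := truncn_itv xic.
set n := Num.trunc _ in n1 n2.
rewrite -(subrK (c * n%:R) xi).
rewrite ler_pdivlMr// mulrC -subr_ge0 in n1.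
rewrite ltr_pdivrMr// mulrC -natr1 mulrDr mulr1 -ltrBlDl in n2.
have xt : `|gam * (xi - c * n%:R)| <= t.
  by rewrite gamle// ger0_norm// (le_trans (ltW n2))// lerDr ltW.
apply: le_trans (bump n _ _); last by rewrite (le_trans xt)// ltW.
by rewrite ler_pM2l// cost.
Qed.

End persistence.

(** * Upper and lower limits at infinity *)

Section limsup.
Context {R : realType}.

(** Meaningful for bounded functions only, which is the case of wave profiles;
    upper and lower limits are then real numbers. *)
Definition limsup_pinfty (h : R -> R) : R :=
  inf [set s | \forall y \near +oo, h y <= s].

Definition liminf_pinfty (h : R -> R) : R := - limsup_pinfty (fun y => - h y).

Lemma limsup_pinfty_le (h : R -> R) (b s : R) : (forall y, b <= h y) ->
  (\forall y \near +oo, h y <= s) -> limsup_pinfty h <= s.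
Proof.
move=> bh hs; apply: ge_inf => //; exists b => t ht.
by have [y hy] := filter_ex ht; exact: le_trans (bh y) hy.
Qed.

Lemma ge_limsup_pinfty (h : R -> R) (b s : R) : (forall y, h y <= b) ->
  (\forall y \near +oo, s <= h y) -> s <= limsup_pinfty h.
Proof.
move=> hb sh; apply: lb_le_inf; first by exists b; exact: nearW.
move=> t ht; have [y [sy yt]] := filter_ex (filterI sh ht).
exact: le_trans sy yt.
Qed.

Lemma near_lt_limsup_pinfty (h : R -> R) (b b' s : R) :
  (forall y, b <= h y <= b') ->
  limsup_pinfty h < s -> \forall y \near +oo, h y <= s.
Proof.
move=> hb hs.
have hi : has_inf [set s | \forall y \near +oo, h y <= s].
  split; first by exists b'; apply: nearW => y; have /andP[] := hb y.
  exists b => t ht; have [y hy] := filter_ex ht.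
  by have /andP[/le_trans + _] := hb y; exact.
have [|t ht ts] := inf_adherent (eps := s - limsup_pinfty h) _ hi.
  by rewrite subr_gt0.
have {}ts : t < s by move: ts; rewrite /limsup_pinfty addrC subrK.
by apply: filterS ht => y hy; exact: le_trans hy (ltW ts).
Qed.

Lemma liminf_pinfty_ge (h : R -> R) (b s : R) : (forall y, h y <= b) ->
  (\forall y \near +oo, s <= h y) -> s <= liminf_pinfty h.
Proof.
move=> hb sh; rewrite lerNr; apply: (@limsup_pinfty_le _ (- b)) => [y|].
  by rewrite lerN2.
by apply: filterS sh => y; rewrite lerN2.
Qed.

Lemma near_gt_liminf_pinfty (h : R -> R) (b b' s : R) :
  (forall y, b <= h y <= b') ->
  s < liminf_pinfty h -> \forall y \near +oo, s <= h y.
Proof.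
move=> hb; rewrite ltrNr => hs.
have : \forall y \near +oo, - h y <= - s.
  apply: (@near_lt_limsup_pinfty _ (- b') (- b)) hs => y.
  by rewrite !lerN2 andbC.
by apply: filterS => y; rewrite lerN2.
Qed.

End limsup.

(** * The competition terms *)

Section load.
Context {R : realType} (m tau : nat).
Variables (e : 'I_m -> nat -> R) (f : 'I_m -> 'I_m -> nat -> R).
Hypothesis e_ge0 : forall i j, (1 <= j < tau)%N -> 0 <= e i j.
Hypothesis f_ge0 :
  forall i l j, l != i -> (1 <= j < tau.+1)%N -> 0 <= f i l j.

(** In a spatially constant state [v], species [i] feels the competition
    [v i + load i v]. *)
Definition load (i : 'I_m) (v : 'I_m -> R) : R :=
  \sum_(1 <= j < tau) e i j * v i
  + \sum_(1 <= j < tau.+1) \sum_(l < m | l != i) f i l j * v l.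

Let q i := competition_sum tau e f i.

Lemma load_le i (v w : 'I_m -> R) :
  (forall l, v l <= w l) -> load i v <= load i w.
Proof.
move=> vw; apply: lerD; apply: ler_sum_nat => j jJ.
  by rewrite ler_wpM2l// e_ge0.
by apply: ler_sum => l li; rewrite ler_wpM2l// f_ge0.
Qed.

Lemma load_ge0 i (v : 'I_m -> R) : (forall l, 0 <= v l) -> 0 <= load i v.
Proof.
move=> v0; rewrite (_ : 0 = load i (fun=> 0)) ?load_le//.
rewrite /load big1 => [|j _]; last by rewrite mulr0.
by rewrite big1 ?addr0// => j _; rewrite big1// => l _; rewrite mulr0.
Qed.

Lemma loadD i (v w : 'I_m -> R) :
  load i (fun l => v l + w l) = load i v + load i w.
Proof.
rewrite /load addrACA -!big_split/=; congr (_ + _).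
  by apply: eq_bigr => j _; rewrite mulrDr.
apply: eq_bigr => j _; rewrite -big_split/=.
by apply: eq_bigr => l _; rewrite mulrDr.
Qed.

Lemma loadZ i (v : 'I_m -> R) (t : R) :
  load i (fun l => v l * t) = load i v * t.
Proof.
rewrite /load mulrDl !mulr_suml; congr (_ + _).
  by apply: eq_bigr => j _; rewrite mulrA.
apply: eq_bigr => j _; rewrite mulr_suml.
by apply: eq_bigr => l _; rewrite mulrA.
Qed.

Lemma load_cst i (t : R) : load i (fun=> t) = q i * t.
Proof.
rewrite /load /q /competition_sum mulrDl !mulr_suml; congr (_ + _).
by apply: eq_bigr => j _; rewrite mulr_suml.
Qed.

Lemma competition_sum_ge0 i : 0 <= q i.
Proof. by rewrite -[q i]mulr1 -load_cst load_ge0. Qed.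

Variables (c : R) (phi : 'I_m -> R -> R).

Let W := wave_competition tau e f c phi.

Let shift_ge (c0 : 0 <= c) (j : nat) y : (j < tau.+1)%N -> y - c * tau%:R <= y - c * j%:R.
Proof. by move=> jt; rewrite lerD2l lerN2 ler_wpM2l// ler_nat. Qed.

(** The competition at [y] involves values of [phi] at [y - c * tau] or later:
    the furthest delay is [tau.-1] in the first sum and, because of the shift by
    [c], also in the second. A bound valid there is propagated by [load]. *)
Lemma wave_competition_le i y (v : 'I_m -> R) : 0 <= c ->
  (forall l y', y - c * tau%:R <= y' -> phi l y' <= v l) ->
  W i y <= phi i y + load i v.
Proof.
move=> c0 phiv; rewrite /W /wave_competition -addrA lerD2l.
apply: lerD; apply: ler_sum_nat => j /andP[j1 jt].
  by rewrite ler_wpM2l ?e_ge0 ?j1// phiv// shift_ge// ltnW.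
apply: ler_sum => l li; rewrite ler_wpM2l ?f_ge0 ?j1// phiv//.
by rewrite (le_trans (shift_ge c0 j y jt))// lerDl.
Qed.

Lemma wave_competition_ge i y (v : 'I_m -> R) : 0 <= c ->
  (forall l y', y - c * tau%:R <= y' -> v l <= phi l y') ->
  phi i y + load i v <= W i y.
Proof.
move=> c0 phiv; rewrite /W /wave_competition -addrA lerD2l.
apply: lerD; apply: ler_sum_nat => j /andP[j1 jt].
  by rewrite ler_wpM2l ?e_ge0 ?j1// phiv// shift_ge// ltnW.
apply: ler_sum => l li; rewrite ler_wpM2l ?f_ge0 ?j1// phiv//.
by rewrite (le_trans (shift_ge c0 j y jt))// lerDl.
Qed.

Lemma wave_competition_continuous i :
  (forall l, continuous (phi l)) -> continuous (W i).
Proof.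
move=> cphi.
have cshift l (a : R) : continuous (fun y => phi l (y + a)).
  move=> y; apply: continuous_comp; last exact: cphi.
  exact: (continuousD (@cvg_id _ _) (@cst_continuous _ _ _ _)).
move=> y; rewrite /continuous_at /W /wave_competition.
apply: cvgD; first apply: cvgD; first exact: cphi.
  apply: cvg_big; first exact: add_continuous.
  by move=> j _; apply: cvgM; [exact: cvg_cst | exact: cshift].
apply: cvg_big; first exact: add_continuous.
move=> j _; apply: cvg_big; first exact: add_continuous.
move=> l _; apply: cvgM; first exact: cvg_cst.
rewrite -addrA; under eq_cvg do rewrite -addrA.
exact: cshift.
Qed.

End load.

(** * Upper and lower limits of a wave *)

(** After clearing denominators the terms in [p * p'] cancel: the saturation by
    the own density [p] does not destroy monotonicity in [p]. *)
Lemma growth_fraction_le (R : realType) (d p p' g g' : R) :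
  0 <= d -> 0 <= p -> p <= p' -> 0 <= g -> g <= g' ->
  (1 + d) * p / (1 + d * (p + g')) <= (1 + d) * p' / (1 + d * (p' + g)).
Proof.
move=> d0 p0 pp' g0 gg'.
have p'0 := le_trans p0 pp'; have g'0 := le_trans g0 gg'.
have den : 0 < 1 + d * (p + g') by rewrite ltr_wpDr// mulr_ge0// addr_ge0.
have den' : 0 < 1 + d * (p' + g) by rewrite ltr_wpDr// mulr_ge0// addr_ge0.
rewrite -!mulrA ler_wpM2l ?addr_ge0// ler_pdivrMr// mulrAC ler_pdivlMr//.
have h : p * (1 + d * g) <= p' * (1 + d * g').
  by apply: ler_pM; rewrite ?addr_ge0 ?mulr_ge0 ?lerD2l ?ler_wpM2l.
have -> : p * (1 + d * (p' + g)) = p * (1 + d * g) + d * p * p' by ring.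
have -> : p' * (1 + d * (p + g')) = p' * (1 + d * g') + d * p * p' by ring.
by rewrite lerD2r.
Qed.

Lemma le_add_small (R : realType) (x y K : R) : 0 <= K ->
  (forall t, 0 < t < 1 -> x <= y + t * K) -> x <= y.
Proof.
move=> K0 xyK; apply/ler_addgt0Pr => eta eta0.
have K1 : 0 < 1 + K + eta by lra.
have t1 : 0 < eta / (1 + K + eta) < 1.
  by rewrite divr_gt0// ltr_pdivrMr// mul1r ltrDr; lra.
apply: le_trans (xyK _ t1) _; rewrite lerD2l mulrAC ler_pdivrMr//.
by rewrite ler_wpM2l// ?ltW//; lra.
Qed.

Section wave.
Context {R : realType} (m tau : nat).
Variables (d : 'I_m -> R) (k : 'I_m -> R -> R).
Variables (e : 'I_m -> nat -> R) (f : 'I_m -> 'I_m -> nat -> R).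
Variables (c : R) (phi : 'I_m -> R -> R).
Hypothesis d_gt0 : forall i, 0 < d i.
Hypothesis k_kernel : forall i, is_kernel (k i).
Hypothesis e_ge0 : forall i j, (1 <= j < tau)%N -> 0 <= e i j.
Hypothesis f_ge0 :
  forall i l j, l != i -> (1 <= j < tau.+1)%N -> 0 <= f i l j.
Hypothesis competition_lt1 : forall i, competition_sum tau e f i < 1.
Hypothesis c_gt0 : 0 < c.
Hypothesis phi_cont : forall i, continuous (phi i).
Hypothesis phi_wave : is_wave tau d k e f c phi.
Hypothesis phi_itv : forall i xi, 0 < phi i xi < 1.

Let W := wave_competition tau e f c phi.
Let q i := competition_sum tau e f i.
Let growth i y := (1 + d i) * phi i y / (1 + d i * W i y).

Let phi_gt0 i y : 0 < phi i y. Proof. by case/andP: (phi_itv i y). Qed.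
Let phi_lt1 i y : phi i y < 1. Proof. by case/andP: (phi_itv i y). Qed.
Let c_ge0 : 0 <= c. Proof. exact: ltW. Qed.
Let d_ge0 i : 0 <= d i. Proof. exact: ltW. Qed.
Let d1_gt0 i : 0 < 1 + d i. Proof. by rewrite addr_gt0. Qed.

Let phi_le_W i y : phi i y <= W i y.
Proof.
have /(_ c_ge0) := wave_competition_ge _ _ _ _ e_ge0 f_ge0 c phi i y (fun=> 0).
move=> /(_ (fun l y' _ => ltW (phi_gt0 l y'))).
by apply: le_trans; rewrite lerDl load_ge0.
Qed.

Let W_le i y : W i y <= phi i y + q i.
Proof.
have /(_ c_ge0) := wave_competition_le _ _ _ _ e_ge0 f_ge0 c phi i y (fun=> 1).
move=> /(_ (fun l y' _ => ltW (phi_lt1 l y'))).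
by rewrite load_cst mulr1.
Qed.

Let den_gt0 i y : 0 < 1 + d i * W i y.
Proof. by rewrite ltr_wpDr// mulr_ge0// (le_trans _ (phi_le_W i y))// ltW. Qed.

Let growth_itv i y : 0 <= growth i y <= 1 + d i.
Proof.
apply/andP; split; first by rewrite divr_ge0 ?mulr_ge0 ?ltW.
rewrite ler_pdivrMr// ler_wpM2l ?(ltW (d1_gt0 i))//.
rewrite (le_trans (ltW (phi_lt1 i y)))// lerDl mulr_ge0//.
by rewrite (le_trans _ (phi_le_W i y))// ltW.
Qed.

Let growth_measurable i : measurable_fun (T := Lebtype R) setT (growth i).
Proof.
apply: continuous_Leb => y; apply: cvgM.
  by apply: cvgM; [exact: cvg_cst | exact: phi_cont].
apply: cvgV; first by rewrite gt_eqF.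
apply: cvgD; first exact: cvg_cst.
by apply: cvgM; [exact: cvg_cst | exact: wave_competition_continuous].
Qed.

Let wave_average i xi :
  phi i xi = \int[@Leb R]_z (growth i (xi - c - z) * k i z).
Proof.
rewrite -(kernel_convolution _ (k_kernel i))//; last first.
  by move=> y; case/andP: (growth_itv i y).
by rewrite phi_wave; apply: eq_Rintegral => y _; rewrite /growth mulrAC.
Qed.

(** As [W i <= phi i + q i], a density below [delta] is multiplied by at least
    [rho = (1 + d i) / (1 + d i * (delta + q i))], which exceeds 1 as soon as
    [delta + q i < 1]. *)
Lemma wave_persistence i :
  exists2 b, 0 < b & \forall y \near +oo, b <= phi i y.
Proof.
pose delta := (1 - q i) / 2.
have q1 : q i < 1 := competition_lt1 i.
have q0 : 0 <= q i := competition_sum_ge0 _ _ _ _ e_ge0 f_ge0 i.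
have delta0 : 0 < delta by rewrite /delta; lra.
have D0 : 0 < 1 + d i * (delta + q i).
  by rewrite ltr_wpDr// mulr_ge0// addr_ge0// ltW.
pose rho := (1 + d i) / (1 + d i * (delta + q i)).
have rho1 : 1 < rho.
  by rewrite /rho ltr_pdivlMr// mul1r ltrD2l gtr_pMr// /delta; lra.
have growth_ge y : rho * Num.min (phi i y) delta <= growth i y.
  have le1 : rho * Num.min (phi i y) delta * (1 + d i * (phi i y + q i)) <= (1 + d i) * phi i y.
    have p0phi : Num.min (phi i y) delta <= phi i y by rewrite ge_min lexx.
    have p0delta : Num.min (phi i y) delta <= delta by rewrite ge_min lexx orbT.
    move: (Num.min _ _) p0phi p0delta => p0 p0phi p0delta.
    have -> : rho * p0 * (1 + d i * (phi i y + q i)) = (1 + d i)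
        * (p0 * (1 + d i * q i) + d i * phi i y * p0) / (1 + d i * (delta + q i)).
      by rewrite /rho; ring.
    rewrite ler_pdivrMr// -[leRHS]mulrA ler_wpM2l ?(ltW (d1_gt0 i))//.
    have -> : phi i y * (1 + d i * (delta + q i)) =
        phi i y * (1 + d i * q i) + d i * phi i y * delta by ring.
    apply: lerD; first by rewrite ler_wpM2r// addr_ge0// mulr_ge0.
    by rewrite ler_wpM2l// mulr_ge0// ltW.
  rewrite /growth ler_pdivlMr// (le_trans _ le1)// ler_wpM2l//.
    by rewrite mulr_ge0 ?le_min ?ltW// (lt_trans _ rho1).
  by rewrite lerD2l ler_wpM2l// W_le.
have [b b0 phib] := persistence (k i) (phi i) (growth i) c rho delta (1 + d i)
  (k_kernel i) c_gt0 rho1 delta0 (phi_cont i) (phi_gt0 i)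
  (growth_measurable i) (growth_itv i) (wave_average i) growth_ge.
exists b => //; near=> y; apply: phib; near: y.
exact: nbhs_pinfty_ge.
Unshelve. all: by end_near. Qed.

Let near_average (P : R -> Prop) A : (\forall y \near +oo, P y) ->
  \forall xi \near +oo, forall z, `|z| <= A -> P (xi - c - z).
Proof.
move=> [Y [Yr YP]]; exists (Y + c + A); split; first exact: num_real.
move=> xi xiY z; rewrite ler_norml => /andP[_ zA]; apply: YP; lra.
Qed.

(** The mass of the kernel that sits near [xi - c] moves to infinity with
    [xi], so eventual bounds of the growth function pass to its averages. *)
Lemma limsup_wave_le i a : 0 <= a ->
  (\forall y \near +oo, growth i y <= a) -> limsup_pinfty (phi i) <= a.
Proof.
move=> a0 ga; apply/ler_addgt0Pr => eta eta0.
have eta'0 : 0 < eta / (1 + d i) by rewrite divr_gt0.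
have [A _ kA] := kernel_average_tight _ (k_kernel i) _ eta'0.
apply: (@limsup_pinfty_le _ _ 0) => [y|]; first exact: ltW.
apply: filterS (near_average _ A ga) => xi gxi.
rewrite wave_average.
have mg : measurable_fun (T := Lebtype R) setT (fun z => growth i (xi - c - z)).
  exact: (measurableT_comp (growth_measurable i) (measurable_reflect _)).
have [+ _] := kA _ _ _ a0 mg (fun z => growth_itv i _) => /(_ gxi).
by rewrite mulrC divfK// gt_eqF.
Qed.

Lemma liminf_wave_ge i a : 0 <= a ->
  (\forall y \near +oo, a <= growth i y) -> a <= liminf_pinfty (phi i).
Proof.
move=> a0 ga; apply/ler_addgt0Pr => eta eta0.
have eta'0 : 0 < eta / (1 + a) by rewrite divr_gt0// ltr_wpDr.
have [A _ kA] := kernel_average_tight _ (k_kernel i) _ eta'0.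
apply: (@le_trans _ _ (a * (1 - eta / (1 + a)) + eta)).
  rewrite mulrBr mulr1 -addrA lerDl addrC subr_ge0 mulrCA.
  by rewrite ger_pMr// ler_pdivrMr ?mul1r ?lerDr// ltr_wpDr.
rewrite lerD2r; apply: (@liminf_pinfty_ge _ _ 1) => [y|]; first exact: ltW.
apply: filterS (near_average _ A ga) => xi gxi.
rewrite wave_average.
have mg : measurable_fun (T := Lebtype R) setT (fun z => growth i (xi - c - z)).
  exact: (measurableT_comp (growth_measurable i) (measurable_reflect _)).
have [_ + ] := kA _ _ _ a0 mg (fun z => growth_itv i _); apply.
move=> z zA; rewrite mulr_natl mulr2n lerD ?gxi//.
by rewrite normrN.
Qed.

Let S l := limsup_pinfty (phi l).
Let I l := liminf_pinfty (phi l).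

Let S_gt0 l : 0 < S l.
Proof.
have [b b0 bphi] := wave_persistence l.
apply: (lt_le_trans b0); apply: (@ge_limsup_pinfty _ _ 1) bphi => y.
exact: ltW.
Qed.

Let I_gt0 l : 0 < I l.
Proof.
have [b b0 bphi] := wave_persistence l.
apply: (lt_le_trans b0); apply: (@liminf_pinfty_ge _ _ 1) bphi => y.
exact: ltW.
Qed.

(** Relative rather than absolute errors keep the lower bounds nonnegative, and
    go through the linear map [load] as plain factors. *)
Let near_le_S t : 0 < t ->
  \forall y \near +oo, forall l, phi l y <= S l * (1 + t).
Proof.
move=> t0; apply: filter_forall => l.
apply: (@near_lt_limsup_pinfty _ _ 0 1) => [y|]; first by rewrite !ltW.
by rewrite -/(S l) ltr_pMr ?S_gt0 ?ltrDl.
Qed.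

Let near_ge_I t : 0 < t ->
  \forall y \near +oo, forall l, I l * (1 - t) <= phi l y.
Proof.
move=> t0; apply: filter_forall => l.
apply: (@near_gt_liminf_pinfty _ _ 0 1) => [y|]; first by rewrite !ltW.
by rewrite -/(I l) gtr_pMr ?I_gt0 ?gtrBl.
Qed.

Let near_shift (P : R -> Prop) : (\forall y \near +oo, P y) ->
  \forall y \near +oo, forall y', y - c * tau%:R <= y' -> P y'.
Proof.
move=> [Y [Yr YP]]; exists (Y + c * tau%:R); split; first exact: num_real.
by move=> y yY y' yy'; apply: YP; rewrite (lt_le_trans _ yy')// ltrBrDr.
Qed.

(** Eventually the growth function is at most its value at the density [S i] and
    the competition [load i I], up to a relative error [t]. Since [S i] is at
    most that value, dividing by [S i > 0] and letting [t] go to 0 gives the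
    claim; the constant multiplying [t] comes from clearing the denominator. *)
Lemma limsup_wave_load i : S i + load m tau e f i I <= 1.
Proof.
have L0 : 0 <= load m tau e f i I by apply: load_ge0 => // l; exact: ltW.
apply: (@le_add_small _ _ _ ((1 + d i) / d i + load m tau e f i I)).
  by rewrite addr_ge0// divr_ge0// ltW.
move=> t /andP[t0 t1].
have t1' : 0 <= 1 - t by rewrite subr_ge0 ltW.
have t2' : 0 <= 1 + t by rewrite addr_ge0 ?ltW.
have Lt0 : 0 <= load m tau e f i I * (1 - t) by rewrite mulr_ge0.
have St0 : 0 <= S i * (1 + t) by rewrite mulr_ge0// ltW.
have den0 : 0 < 1 + d i * (S i * (1 + t) + load m tau e f i I * (1 - t)).
  by rewrite ltr_wpDr// mulr_ge0// addr_ge0.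
have : S i <= (1 + d i) * (S i * (1 + t)) /
    (1 + d i * (S i * (1 + t) + load m tau e f i I * (1 - t))).
  apply: limsup_wave_le.
    by rewrite divr_ge0// ?(ltW den0)// mulr_ge0// ltW.
  apply: filterS2 (near_le_S _ t0) (near_shift _ (near_ge_I _ t0)) => y phiS phiI.
  rewrite /growth -(subrK (phi i y) (W i y)) [_ - _ + _]addrC.
  apply: growth_fraction_le; rewrite ?(ltW (phi_gt0 _ _))//.
  rewrite lerBrDl -loadZ; apply: wave_competition_ge => // l y' /phiI.
  exact.
rewrite ler_pdivlMr// mulrCA ler_pM2l// => h.
have dS : 0 <= d i * S i * t by rewrite !mulr_ge0// ltW.
rewrite -(ler_pM2l (d_gt0 i)).
have -> : d i * (1 + t * ((1 + d i) / d i + load m tau e f i I)) =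
    d i + t * (1 + d i + d i * load m tau e f i I).
  by field; rewrite gt_eqF.
move: (load _ _ _ _ _ _) h => L h; nra.
Qed.

Lemma liminf_wave_load i : 1 <= I i + load m tau e f i S.
Proof.
have L0 : 0 <= load m tau e f i S by apply: load_ge0 => // l; exact: ltW.
apply: (@le_add_small _ _ _ ((1 + d i) / d i + load m tau e f i S)).
  by rewrite addr_ge0// divr_ge0// ltW.
move=> t /andP[t0 t1].
have t1' : 0 <= 1 - t by rewrite subr_ge0 ltW.
have t2' : 0 <= 1 + t by rewrite addr_ge0 ?ltW.
have Lt0 : 0 <= load m tau e f i S * (1 + t) by rewrite mulr_ge0.
have It0 : 0 <= I i * (1 - t) by rewrite mulr_ge0// ltW.
have den0 : 0 < 1 + d i * (I i * (1 - t) + load m tau e f i S * (1 + t)).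
  by rewrite ltr_wpDr// mulr_ge0// addr_ge0.
have : (1 + d i) * (I i * (1 - t)) /
    (1 + d i * (I i * (1 - t) + load m tau e f i S * (1 + t))) <= I i.
  apply: liminf_wave_ge.
    by rewrite divr_ge0// ?(ltW den0)// mulr_ge0// ltW.
  apply: filterS2 (near_ge_I _ t0) (near_shift _ (near_le_S _ t0)) => y phiI phiS.
  rewrite /growth -(subrK (phi i y) (W i y)) [_ - _ + _]addrC.
  apply: growth_fraction_le; rewrite ?subr_ge0//.
  rewrite lerBlDl -loadZ; apply: wave_competition_le => // l y' /phiS.
  exact.
rewrite ler_pdivrMr// mulrCA ler_pM2l// => h.
have dI : 0 <= d i * I i * t by rewrite !mulr_ge0// ltW.
rewrite -(ler_pM2l (d_gt0 i)).
have -> : d i * (I i + load m tau e f i S + t * ((1 + d i) / d i + load m tau e f i S)) =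
    d i * (I i + load m tau e f i S) + t * (1 + d i + d i * load m tau e f i S).
  by field; rewrite gt_eqF.
move: (load _ _ _ _ _ _) h => L h; nra.
Qed.

(** A contraction argument in the maximum norm. If [u i] is the largest deviation
    of [S] and [I] from [E], then [E - u i <= I] and [S <= E + u i]; inserting
    this in the two inequalities above gives [u i <= q i * u i] with
    [q i < 1]. *)
Let E_bounds (E : 'I_m -> R) : is_equilibrium tau e f E ->
  forall i, S i <= E i <= I i.
Proof.
move=> eqE i0.
have EL i : E i + load m tau e f i E = 1 by rewrite -(eqE i) addrA.
pose u l := Num.max (S l - E l) (E l - I l).
have [i _ umax] := @arg_maxP _ _ _ i0 xpredT u isT.
have Iu l : E l + - u i <= I l.
  by rewrite lerBlDr -lerBlDl (le_trans _ (umax l isT))// le_max lexx orbT.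
have Su l : S l <= E l + u i.
  by rewrite -lerBlDl (le_trans _ (umax l isT))// le_max lexx.
have ui0 : u i <= 0.
  have := load_le _ _ _ _ e_ge0 f_ge0 i _ _ Iu.
  have := load_le _ _ _ _ e_ge0 f_ge0 i _ _ Su.
  rewrite !loadD !load_cst.
  have := limsup_wave_load i; have := liminf_wave_load i; have := EL i.
  have := competition_lt1 i.
  have : u i = S i - E i \/ u i = E i - I i.
    by rewrite /u maxEle; case: ifP => _; [right|left].
  move: (u i) (load m tau e f i E) (load m tau e f i S) (load m tau e f i I).
  move: (competition_sum _ _ _ _) (S i) (I i) (E i) => Q Si Ii Ei u' LE LS LI.
  by move=> ? ? ? ? ? ? ?; nra.
apply/andP; split.
  by rewrite (le_trans (Su i0))// gerDl.
by rewrite (le_trans _ (Iu i0))// lerDl oppr_ge0.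
Qed.

Lemma wave_cvg_equilibrium (E : 'I_m -> R) : is_equilibrium tau e f E ->
  forall i, phi i xi @[xi --> +oo] --> E i.
Proof.
move=> /E_bounds SEI i; have /andP[SE EI] := SEI i.
apply/cvgrPdist_le => eps eps0.
have phi01 y : 0 <= phi i y <= 1 by rewrite !ltW.
have up : \forall y \near +oo, phi i y <= E i + eps.
  apply: near_lt_limsup_pinfty phi01 _.
  by rewrite (le_lt_trans SE)// ltrDl.
have lo : \forall y \near +oo, E i - eps <= phi i y.
  apply: near_gt_liminf_pinfty phi01 _.
  by rewrite (lt_le_trans _ EI)// gtrBl.
apply: filterS2 up lo => y ? ?; rewrite ler_norml; apply/andP; split; lra.
Qed.

End wave.

(** * Positivity of the speed, and the limit at minus infinity *)

Lemma speed_ge0 (R : realType) (d : R) (k : R -> R) :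
  0 <= d -> is_kernel k -> 0 <= speed d k.
Proof.
move=> d0 kerk; apply: lb_le_inf.
  by eexists; exists 1; [exact: ltr01 | reflexivity].
move=> _ [l /= l0 <-]; rewrite divr_ge0 ?(ltW l0)// ln_ge0//.
by rewrite mulr_ege1 ?lerDl// kernel_exp_moment_ge1.
Qed.

Lemma Cmax_ge0 (R : realType) (m : nat) (d : 'I_m -> R) (k : 'I_m -> R -> R) :
  (0 < m)%N -> (forall i, 0 <= d i) -> (forall i, is_kernel (k i)) ->
  (0 <= Cmax d k)%E.
Proof.
move=> m0 d0 kerk; pose i := Ordinal m0.
apply: (@le_trans _ _ (speed (d i) (k i))%:E); first by rewrite lee_fin speed_ge0.
exact: (le_bigmax _ (fun i => (speed (d i) (k i))%:E)).
Qed.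

Lemma unif_continuous_continuous (R : realType) (u : R -> R) :
  unif_continuous u -> continuous u.
Proof.
move=> /unif_continuousP uu x; apply/cvgrPdist_lt => eps /uu[del /= del0 u_del].
by exists del => //= y xy; apply: (u_del (x, y)).
Qed.

Lemma cvg0_of_exp_asymptotics (R : realType) (u : R -> R) (l : R) : 0 < l ->
  u xi * expR (- l * xi) @[xi --> -oo] --> (1 : R) ->
  u xi @[xi --> -oo] --> (0 : R).
Proof.
move=> l0 u1.
have e0 : expR (l * xi) @[xi --> -oo] --> (0 : R).
  apply/cvgrPdist_le => eps eps0; exists (ln eps / l); split=> [|xi xi_lt].
    exact: num_real.
  rewrite sub0r normrN ger0_norm ?expR_ge0// -[leRHS]lnK ?posrE// ler_expR.
  by rewrite mulrC -ler_pdivlMr// ltW.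
rewrite -[X in _ --> X](mul1r (0 : R)).
suff -> : u = fun xi => u xi * expR (- l * xi) * expR (l * xi) by exact: cvgM.
by apply/funext => xi; rewrite -mulrA mulrC -expRD mulNr addNr expR0 mul1r.
Qed.

Theorem theorem5p15 (R : realType) (m tau : nat)
  (d : 'I_m -> R) (k : 'I_m -> R -> R)
  (e : 'I_m -> nat -> R) (f : 'I_m -> 'I_m -> nat -> R)
  (c : R) (lambda E : 'I_m -> R) (phi : 'I_m -> R -> R)
  (m_gt0 : (0 < m)%N) (tau_gt0 : (0 < tau)%N)
  (d_gt0 : forall i, 0 < d i)
  (k_kernel : forall i, is_kernel (k i))
  (e_ge0 : forall i j, (1 <= j < tau)%N -> 0 <= e i j)
  (f_ge0 : forall i l j, l != i -> (1 <= j < tau.+1)%N -> 0 <= f i l j)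
  (competition_lt1 : forall i, competition_sum tau e f i < 1)
  (E_gt0 : forall i, 0 < E i)
  (E_equilibrium : is_equilibrium tau e f E)
  (c_gtC : (Cmax d k < c%:E)%E)
  (lambda_root : forall i,
    is_smallest_pos_root (fun l => Lambda (d i) (k i) l c) 1 (lambda i))
  (phi_bounded : forall i, bounded_fun (phi i))
  (phi_unif : forall i, unif_continuous (phi i))
  (phi_wave : is_wave tau d k e f c phi)
  (phi_itv : forall i xi, 0 < phi i xi < 1)
  (phi_ninfty : forall i,
    phi i xi * expR (- lambda i * xi) @[xi --> -oo] --> (1 : R)) :
  forall i, (phi i xi @[xi --> -oo] --> (0 : R))
         /\ (phi i xi @[xi --> +oo] --> E i).
Proof.
move=> i; split.
  by have [l0 _ _] := lambda_root i; exact: cvg0_of_exp_asymptotics l0 _.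
have c_gt0 : 0 < c.
  rewrite -lte_fin; apply: le_lt_trans c_gtC.
  by apply: Cmax_ge0 => // l; exact: ltW.
apply: (@wave_cvg_equilibrium _ _ tau d k e f c) => // l.
exact: unif_continuous_continuous.
Qed.
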